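(* Let $G=(A\cup B,E)$ be a bipartite graph in which every node has a strict ranking of its neighbors and which admits a perfect matching; let $n_0=|A|=|B|$. Let $M$ be a popular perfect matching in $G$ (a perfect matching with $\Delta(M,N)\ge0$ for every perfect matching $N$), and let $\vec\alpha$ be an optimal solution of the linear program $\min\sum_{u\in A\cup B}y_u$ s.t. $y_a+y_b\ge\mathsf{wt}_M(a,b)$ for all $(a,b)\in E$, with $\alpha_a\in\{0,-2,\ldots,-2(n_0-1)\}$ for all $a\in A$ and $\alpha_b\in\{0,2,\ldots,2(n_0-1)\}$ for all $b\in B$. Define the matching $S$ of $G^*$ as $$S=\bigcup_{i=0}^{n_0-1}\{(a_i,\tilde b): (a,b)\in M,\ \alpha_a=-2i,\ \alpha_b=2i\}\ \cup\ D,$$ where $D$ consists, for each $a\in A$ with $\alpha_a=-2i$, of the edges $(a_j,d_{j+1}(a))$ for $0\le j\le i-1$ and $(a_j,d_j(a))$ for $i+1\le j\le n_0-1$. Then $S$ is a stable matching in $G^*$.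
   Context: Node $u$ prefers matching $M$ to $N$ if $u$ is matched in $M$ and unmatched in $N$, or matched in both and prefers its partner in $M$. $\phi(M,N)$ is the number of nodes preferring $M$ to $N$, $\Delta(M,N)=\phi(M,N)-\phi(N,M)$. An edge $(u,v)$ blocks a matching if each of $u,v$ is unmatched or prefers the other to its partner; a matching is stable if no edge blocks it. $\mathsf{wt}_M(a,b)=2$ if $(a,b)$ blocks $M$; $-2$ if $a$ and $b$ both prefer their assignments in $M$ to each other; $0$ otherwise. The instance $G^*=(A^*\cup B^*,E^* )$ (with $n_0=|A|$): $A^*=\{a_i:a\in A,0\le i\le n_0-1\}$; $B^*=\{\tilde b:b\in B\}\cup\{d_i(a):a\in A,1\le i\le n_0-1\}$. $E^*$ contains $(a_i,\tilde b)$ for $(a,b)\in E$, $0\le i\le n_0-1$, and $(a_{i-1},d_i(a)),(a_i,d_i(a))$ for $a\in A$, $1\le i\le n_0-1$. If $a$ ranks $b_1\succ\cdots\succ b_k$ in $G$: $a_0$ ranks $\tilde b_1\succ\cdots\succ\tilde b_k\succ d_1(a)$; $a_i$ ($1\le i\le n_0-2$) ranks $d_i(a)\succ\tilde b_1\succ\cdots\succ\tilde b_k\succ d_{i+1}(a)$; $a_{n_0-1}$ ranks $d_{n_0-1}(a)\succ\tilde b_1\succ\cdots\succ\tilde b_k$ (if $n_0=1$, $a_0$ ranks $\tilde b_1\succ\cdots\succ\tilde b_k$). $d_i(a)$ ranks $a_{i-1}\succ a_i$. $\tilde b$ ranks all subscript-$(n_0-1)$ neighbors first, then subscript $n_0-2$,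 ..., subscript $0$ last; within subscript $i$, $\tilde b$ prefers $z_i$ to $z'_i$ iff $b$ prefers $z$ to $z'$ in $G$. *)

(* Defs.v *)
From HB Require Import structures.
From mathcomp Require Import all_boot all_order all_algebra.

Set Implicit Arguments.
Unset Strict Implicit.
Unset Printing Implicit Defensive.

Import Order.TTheory GRing.Theory Num.Theory.
Local Open Scope ring_scope.

(* [prefA a b b'] reads "a prefers b to b'" (likewise [prefB]); only its values *)
(* on neighbors of [a] matter.                                                *)
Record bip_inst (A B : finType) := BipInst {
  edge  : A -> B -> bool;
  prefA : A -> rel B;
  prefB : B -> rel A
}.

Definition ranks_strictly (T : finType) (D : pred T) (r : rel T) : Prop :=
  [/\ forall x, D x -> ~~ r x x,
      forall x y z, D x -> D y -> D z -> r x y -> r y z -> r x z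
    & forall x y, D x -> D y -> x != y -> r x y || r y x].

Definition strict_rankings (A B : finType) (G : bip_inst A B) : Prop :=
  (forall a, ranks_strictly (edge G a) (prefA G a)) /\
  (forall b, ranks_strictly (fun a => edge G a b) (prefB G b)).

Section Matchings.
Variables (A B : finType) (G : bip_inst A B).
Implicit Types (M N : {set A * B}) (a : A) (b : B).

Definition is_matching M : Prop :=
  [/\ forall a b, (a, b) \in M -> edge G a b,
      forall a b b', (a, b) \in M -> (a, b') \in M -> b = b'
    & forall a a' b, (a, b) \in M -> (a', b) \in M -> a = a'].

Definition matchedA M a : bool := [exists b, (a, b) \in M].
Definition matchedB M b : bool := [exists a, (a, b) \in M].

Definition perfect_matching M : Prop :=
  [/\ is_matching M, forall a, matchedA M a & forall b, matchedB M b].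

Definition node_prefers M N (u : A + B) : bool :=
  match u with
  | inl a => (matchedA M a && ~~ matchedA N a)
      || [exists b, exists b',
            [&& (a, b) \in M, (a, b') \in N & prefA G a b b']]
  | inr b => (matchedB M b && ~~ matchedB N b)
      || [exists a, exists a',
            [&& (a, b) \in M, (a', b) \in N & prefB G b a a']]
  end.

Definition phi M N : nat := #|[set u | node_prefers M N u]|.

Definition Delta M N : int := (phi M N)%:Z - (phi N M)%:Z.

Definition popular_perfect M : Prop :=
  perfect_matching M /\ forall N, perfect_matching N -> 0 <= Delta M N.

Definition blocks M a b : bool :=
  [&& edge G a b,
      ~~ matchedA M a || [exists b', ((a, b') \in M) && prefA G a b b']
    & ~~ matchedB M b || [exists a', ((a', b) \in M) && prefB G b a a']].

Definition stable_matching M : Prop :=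
  is_matching M /\ forall a b, ~~ blocks M a b.

Definition wt M a b : int :=
  if blocks M a b then 2
  else if [exists b', ((a, b') \in M) && prefA G a b' b]
          && [exists a', ((a', b) \in M) && prefB G b a' a]
  then -2 else 0.

Definition lp_feasible (R : realFieldType) M (y : A + B -> R) : Prop :=
  forall a b, edge G a b -> (wt M a b)%:~R <= y (inl a) + y (inr b).

Definition lp_optimal (R : realFieldType) M (y : A + B -> R) : Prop :=
  lp_feasible M y /\
  forall z : A + B -> R, lp_feasible M z -> \sum_u y u <= \sum_u z u.

End Matchings.

Section Gstar.
Variables (A B : finType) (n0 : nat).

(* The pair (a, i) is a_i. *)
Definition Astar : finType := (A * 'I_n0)%type.

(* [inl b] is the node written b with a tilde, and [inr (a, k)] is d_{k+1}(a): *)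
(* the indices of the d's are shifted down by one.                            *)
Definition Bstar : finType := (B + A * 'I_n0.-1)%type.

Definition edge_star (G : bip_inst A B) (u : Astar) (v : Bstar) : bool :=
  match v with
  | inl b => edge G u.1 b
  | inr (a, k) =>
      (a == u.1) && ((u.2 == k :> nat) || (u.2 == k.+1 :> nat))
  end.

(* Position of a neighbor of a_i: d_i(a) first, then the copies of the        *)
(* neighbors of a, then d_{i+1}(a).                                           *)
Definition tier (u : Astar) (v : Bstar) : nat :=
  match v with
  | inl _ => 1
  | inr (_, k) => if u.2 == k.+1 :> nat then 0 else 2
  end.

Definition prefA_star (G : bip_inst A B) (u : Astar) (v w : Bstar) : bool :=
  match v, w with
  | inl b, inl b' => prefA G u.1 b b'
  | _, _ => (tier u v < tier u w)%N
  end.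

Definition prefB_star (G : bip_inst A B) (v : Bstar) (u w : Astar) : bool :=
  match v with
  | inl b => (w.2 < u.2)%N || ((u.2 == w.2) && prefB G b u.1 w.1)
  | inr _ => (u.2 < w.2)%N
  end.

Definition Gstar (G : bip_inst A B) : bip_inst Astar Bstar :=
  BipInst (edge_star G) (prefA_star G) (prefB_star G).

Variables (R : realFieldType) (M : {set A * B}) (alpha : A + B -> R).

Definition S_main : {set Astar * Bstar} :=
  \bigcup_(i < n0)
    [set (((e.1, i), inl e.2) : Astar * Bstar)
      | e in M & (alpha (inl e.1) == - (2 * i)%:R)
                 && (alpha (inr e.2) == (2 * i)%:R)].

(* With the index shift, (a_j, d_{j+1}(a)) is the case k = j and              *)
(* (a_j, d_j(a)) is the case k + 1 = j.                                       *)
Definition in_D (e : Astar * Bstar) : bool :=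
  match e with
  | (_, inl _) => false
  | ((a, j), inr (a', k)) =>
      (a' == a) &&
      [exists i : 'I_n0, (alpha (inl a) == - (2 * i)%:R) &&
         (((j < i)%N && (k == j :> nat)) || ((i < j)%N && (k.+1 == j :> nat)))]
  end.

Definition S_dummy : {set Astar * Bstar} := [set e | in_D e].

Definition S_matching : {set Astar * Bstar} := S_main :|: S_dummy.

End Gstar.

Lemma Gstar_strict (A B : finType) (n0 : nat) (G : bip_inst A B) :
  strict_rankings G -> strict_rankings (Gstar n0 G).
Proof.
move=> [sA sB]; split.
- move=> [a i]; have [irr tr tot] := sA a; split.
  + by case=> [b|[a' k]] /=; [exact: irr | rewrite ltnn].
  + case=> [b|[a1 k1]] [b'|[a2 k2]] [b''|[a3 k3]] //=; rewrite /tier /=;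
      do ?case: ifP => //; exact: tr.
  + case=> [b|[a1 k1]] [b'|[a2 k2]] //=; rewrite /tier /=.
    * by move=> hb hb' ne; apply: tot => //; apply: contra_neq ne => ->.
    * by case: ifP.
    * by case: ifP.
    * move=> /andP[/eqP -> h1] /andP[/eqP -> h2].
      have [e1|e1] := eqVneq (i : nat) k1.+1; have [e2|e2] := eqVneq (i : nat) k2.+1 => //.
        move=> /negP[]; apply/eqP; congr (inr (_, _)); apply: val_inj.
        by move: e1; rewrite e2 => -[].
      move: h1 h2; rewrite (negbTE e1) (negbTE e2) !orbF => /eqP h1 /eqP h2.
      by move=> /negP[]; apply/eqP; congr (inr (_, _)); apply: val_inj; rewrite /= -h1.
- case=> [b|[a k]].
  + have [irr tr tot] := sB b; split.
    * by move=> [z i] /= hz; rewrite ltnn eqxx /= irr.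
    * move=> [x i] [y j] [z l] /= hx hy hz.
      move=> /orP[h1|/andP[/eqP <- h1]] /orP[h2|/andP[/eqP <- h2]].
      - by rewrite (ltn_trans h2 h1).
      - by rewrite h1.
      - by rewrite h2.
      - by rewrite eqxx (tr _ _ _ hx hy hz h1 h2) orbT.
    * move=> [x i] [y j] /= hx hy ne.
      case: (ltngtP i j) => [h|h|/val_inj h]; rewrite ?orbT //.
      rewrite h eqxx /=; apply: tot => //.
      by apply: contra_neq ne => ->; rewrite h.
  + split=> [[x i] _|[x i] [y j] [z l] _ _ _|[x i] [y j]] /=.
    * by rewrite ltnn.
    * exact: ltn_trans.
    * move=> /andP[/eqP <- _] /andP[/eqP <- _] ne.
      rewrite -neq_ltn; apply: contra_neq ne => /val_inj -> //.
Qed.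

(* Main.v *)
Require Import Defs.
From mathcomp Require Import all_boot all_order all_algebra.
From mathcomp Require Import zify lra.

Set Implicit Arguments.
Unset Strict Implicit.
Unset Printing Implicit Defensive.

Import Order.TTheory GRing.Theory Num.Theory.
Local Open Scope ring_scope.

(** Since [M] is popular, no perfect matching has positive weight under [wt M],
    and this forces [alpha] to be tight on [M]: if an edge of [M] at [a0] had
    slack, follow alternating paths of tight edges from [a0].  Either some path
    closes up, and switching [M] along the cycle yields a perfect matching of
    positive weight, or shifting [alpha] by one along the reachable nodes gives
    a cheaper feasible solution.  Tightness says that [a] and its partner in [M]
    have the same level [i], so [S] matches every node of [G*], and an edge
    [(a_j, b~)] blocking [S] would contradict [alpha_a + alpha_b >= wt a b]. *)

(** * Perfect matchings as bijections; weights and votes *)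

Section PerfectMatchings.
Variables (A B : finType) (G : bip_inst A B).
Implicit Types (M N : {set A * B}) (f g : A -> B).

(** The function gives each node of [A] its partner; when it is bijective, its inverse gives the
    partners of the nodes of [B]. *)
Definition matching_fun M f := forall a b, ((a, b) \in M) = (f a == b).

Lemma perfect_matching_fun M : perfect_matching G M ->
  exists f, [/\ matching_fun M f, bijective f & forall a, edge G a (f a)].
Proof.
move=> [[Me MA MB] mA mB].
have /fin_all_exists[f fM] : forall a, exists b, (a, b) \in M.
  by move=> a; apply/existsP; exact: mA.
have /fin_all_exists[f' f'M] : forall b, exists a, (a, b) \in M.
  by move=> b; apply/existsP; exact: mB.
exists f; split=> [a b||a]; last exact: Me.
- apply/idP/eqP => [abM|<-//]; exact: MA (fM a) abM.
- exists f' => [a|b]; [exact: MB (f'M (f a)) (fM a)|exact: MA (fM _) (f'M b)].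
Qed.

Lemma perfect_matching_image f : bijective f -> (forall a, edge G a (f a)) ->
  perfect_matching G [set e | f e.1 == e.2].
Proof.
move=> [f' fK f'K] fE; split; first split.
- by move=> a b; rewrite inE /= => /eqP <-.
- by move=> a b b'; rewrite !inE /= => /eqP <- /eqP.
- by move=> a a' b; rewrite !inE /= => /eqP <- /eqP /(can_inj fK).
- by move=> a; apply/existsP; exists (f a); rewrite inE.
- by move=> b; apply/existsP; exists (f' b); rewrite inE /= f'K.
Qed.

Section MatchingFun.
Variables (M : {set A * B}) (f : A -> B) (f' : B -> A).
Hypotheses (Mf : matching_fun M f) (fK : cancel f f') (f'K : cancel f' f).

Lemma matching_fun_matchedA a : matchedA M a.
Proof. by apply/existsP; exists (f a); rewrite Mf. Qed.

Lemma matching_fun_matchedB b : matchedB M b.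
Proof. by apply/existsP; exists (f' b); rewrite Mf f'K. Qed.

Lemma exists_partnerA (P : pred B) a :
  [exists b, ((a, b) \in M) && P b] = P (f a).
Proof.
apply/existsP/idP => [[b]|Pfa]; first by rewrite Mf => /andP[/eqP ->].
by exists (f a); rewrite Mf eqxx.
Qed.

Lemma exists_partnerB (P : pred A) b :
  [exists a, ((a, b) \in M) && P a] = P (f' b).
Proof.
apply/existsP/idP => [[a]|Pfb].
  by rewrite Mf => /andP[/eqP <-]; rewrite fK.
by exists (f' b); rewrite Mf f'K eqxx.
Qed.

Lemma blocksE a b :
  blocks G M a b = [&& edge G a b, prefA G a b (f a) & prefB G b a (f' b)].
Proof.
rewrite /blocks matching_fun_matchedA matching_fun_matchedB /=.
by rewrite exists_partnerA (exists_partnerB (prefB G b a)).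
Qed.

Lemma wtE a b : wt G M a b =
  if [&& edge G a b, prefA G a b (f a) & prefB G b a (f' b)] then 2
  else if prefA G a (f a) b && prefB G b (f' b) a then -2 else 0.
Proof.
rewrite /wt blocksE (exists_partnerA (fun b' => prefA G a b' b)).
by rewrite (exists_partnerB (fun a' => prefB G b a' a)).
Qed.

Lemma wt_partner a : strict_rankings G -> edge G a (f a) ->
  wt G M a (f a) = 0.
Proof.
move=> [sA _] ae; have [irr _ _] := sA a.
by rewrite wtE fK (negbTE (irr _ ae)) /= andbF.
Qed.

End MatchingFun.

Lemma node_prefersA M N f g a : matching_fun M f -> matching_fun N g ->
  node_prefers G M N (inl a) = prefA G a (f a) (g a).
Proof.
move=> Mf Ng /=; rewrite (matching_fun_matchedA Ng) andbF /=.
rewrite -(exists_partnerA Mf (fun b => prefA G a b (g a))).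
apply: eq_existsb => b; rewrite -(exists_partnerA Ng (prefA G a b)).
apply/existsP/andP => [[b' /and3P[h1 h2 h3]]|[h1 /existsP[b' /andP[h2 h3]]]].
  by split=> //; apply/existsP; exists b'; rewrite h2.
by exists b'; rewrite h1 h2.
Qed.

Lemma node_prefersB M N f (f' : B -> A) g (g' : B -> A) b :
  matching_fun M f -> cancel f f' -> cancel f' f ->
  matching_fun N g -> cancel g g' -> cancel g' g ->
  node_prefers G M N (inr b) = prefB G b (f' b) (g' b).
Proof.
move=> Mf fK f'K Ng gK g'K /=.
rewrite (matching_fun_matchedB Ng g'K) andbF /=.
rewrite -(exists_partnerB Mf fK f'K (fun a => prefB G b a (g' b))).
apply: eq_existsb => a; rewrite -(exists_partnerB Ng gK g'K (prefB G b a)).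
apply/existsP/andP => [[b' /and3P[h1 h2 h3]]|[h1 /existsP[b' /andP[h2 h3]]]].
  by split=> //; apply/existsP; exists b'; rewrite h2.
by exists b'; rewrite h1 h2.
Qed.

Lemma phi_sum M N f (f' : B -> A) g (g' : B -> A) :
  matching_fun M f -> cancel f f' -> cancel f' f ->
  matching_fun N g -> cancel g g' -> cancel g' g ->
  phi G M N = (\sum_a prefA G a (f a) (g a)
               + \sum_b prefB G b (f' b) (g' b))%N.
Proof.
move=> Mf fK f'K Ng gK g'K.
rewrite /phi cardsE -sum1_card big_mkcond big_sumType /=.
congr (_ + _)%N; apply: eq_bigr => u _.
  by rewrite -topredE /= -[X in (if X then _ else _)]/(node_prefers G M N (inl u))
    (node_prefersA _ Mf Ng); case: prefA.
by rewrite -topredE /= -[X in (if X then _ else _)]/(node_prefers G M N (inr u))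
  (node_prefersB _ Mf fK f'K Ng gK g'K); case: prefB.
Qed.

Lemma ranks_strictly_asym (T : finType) (D : pred T) (r : rel T) x y :
  ranks_strictly D r -> D x -> D y -> r x y -> r y x = false.
Proof.
move=> [irr tr _] Dx Dy rxy; apply/negP => ryx.
by move/negP: (irr _ Dx); apply; exact: tr rxy ryx.
Qed.

Lemma ranks_strictly_rev (T : finType) (D : pred T) (r : rel T) x y :
  ranks_strictly D r -> D x -> D y -> x != y -> r y x = ~~ r x y.
Proof.
move=> sr Dx Dy xy; case rxy: (r x y) => /=.
  exact: ranks_strictly_asym sr Dx Dy rxy.
by case: sr => _ _ /(_ _ _ Dx Dy xy); rewrite rxy.
Qed.

(** Rankings are strict, so [wt] of an edge of [N] is the sum of the votes of its two ends between
    [N] and [M], each 1 or -1, or 0 when the edge is also in [M]. The edges of [N] partition the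
    nodes, so the total is the vote for [N] against [M]. *)
Lemma sum_wt M N f g : strict_rankings G ->
  matching_fun M f -> bijective f -> (forall a, edge G a (f a)) ->
  matching_fun N g -> bijective g -> (forall a, edge G a (g a)) ->
  \sum_a wt G M a (g a) = - Delta G M N.
Proof.
move=> [sA sB] Mf [f' fK f'K] fE Ng [g' gK g'K] gE.
have reB (F : B -> nat) : (\sum_b F b = \sum_a F (g a))%N.
  by rewrite (reindex g) //; exists g' => ? _.
rewrite /Delta (phi_sum Mf fK f'K Ng gK g'K).
rewrite (phi_sum Ng gK g'K Mf fK f'K) !reB -!big_split /=.
rewrite opprB !(big_morph Posz PoszD (erefl (Posz 0))) -sumrB.
apply: eq_bigr => a _; rewrite (wtE Mf fK f'K) gE gK /=.
have fgE : edge G (f' (g a)) (g a) by rewrite -{2}(f'K (g a)).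
have [e|ne] := eqVneq (f a) (g a).
  have [irrA _ _] := sA a; have [irrB _ _] := sB (g a).
  by rewrite -e fK e (negbTE (irrA _ (gE a))) (negbTE (irrB _ (gE a))).
have ne' : f' (g a) != a by apply: contra_neq ne => {1}<-; rewrite f'K.
rewrite (ranks_strictly_rev (sA a) (fE a) (gE a) ne).
rewrite (ranks_strictly_rev (sB (g a)) fgE (gE a) ne').
by case: prefA; case: prefB.
Qed.

(** * Tightness of an integral optimal dual solution on [M] *)

Lemma popular_perfect_tight (R : realFieldType) M f (alpha : A + B -> R) :
  strict_rankings G -> popular_perfect G M -> lp_optimal G M alpha ->
  (forall u, exists z : int, alpha u = z%:~R) ->
  matching_fun M f -> bijective f -> (forall a, edge G a (f a)) ->
  forall a, alpha (inl a) + alpha (inr (f a)) = 0.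
Proof.
move=> sG [_ popM] [feas opt] int_alpha Mf bij_f fE a0.
have [f' fK f'K] := bij_f.
have M_ge0 a : 0 <= alpha (inl a) + alpha (inr (f a)).
  by have := feas a _ (fE a); rewrite (wt_partner Mf fK f'K).
have := M_ge0 a0; rewrite le_eqVlt => /orP[/eqP<- //|slack]; exfalso.
(* One step follows the [M]-edge from [x] to [f x], then a tight edge from [f x] to [y]. *)
pose tight : rel A := [rel x y | edge G y (f x)
  && (alpha (inl y) + alpha (inr (f x)) == (wt G M y (f x))%:~R)].
(* [C] allows the empty path and [X] does not, so they can differ only at [a0]. *)
pose C := [set x | connect tight a0 x].
pose X := [set x | [exists y in C, tight y x]].
have [|a0X] := boolP (a0 \in X).
  rewrite inE => /existsP[y /andP[]]; rewrite inE => /connectP[p0 p0P ->].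
  case/shortenP: p0P => p pP Up _ closing.
  have [c [cyc Uc a0c]] : exists c, [/\ cycle tight c, uniq c & a0 \in c].
    by exists (a0 :: p); rewrite mem_head /= rcons_path pP.
  have bij_prev : bijective (prev c) by exists (next c); [exact: next_prev|exact: prev_next].
  (* [prev c] fixes every node off the cycle, so [g] keeps [M] there and uses the tight edges on the
     cycle. *)
  pose g a := f (prev c a).
  have bij_g : bijective g by exact: bij_comp.
  have gT a : a \in c -> tight (prev c a) a by exact: prev_cycle.
  have gout a : a \notin c -> g a = f a by move=> ac; rewrite /g prev_nth (negbTE ac).
  have gE a : edge G a (g a).
    have [/gT /andP[]//|/gout->//] := boolP (a \in c).
  have Ng : matching_fun [set e | g e.1 == e.2] g by move=> a b; rewrite inE.
  have := sum_wt sG Mf bij_f fE Ng bij_g gE.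
  have := popM _ (perfect_matching_image bij_g gE).
  suff : 0 < (\sum_a wt G M a (g a))%:~R :> R by rewrite ltr0z; lia.
  rewrite rmorph_sum /=.
  have -> : \sum_a (wt G M a (g a))%:~R
      = \sum_a (if a \in c then alpha (inl a) + alpha (inr (f a)) else 0).
    (* On the cycle each new edge weighs the sum of its end values. Reindexing the [B]-terms by
       [prev c] regroups these along the edges of [M], so the weight is the total slack of [M] on
       the cycle, where [a0] contributes a positive amount. *)
    transitivity (\sum_a (if a \in c then alpha (inl a) else 0)
       + \sum_a (if a \in c then alpha (inr (f a)) else 0)); last first.
      by rewrite -big_split; apply: eq_bigr => a _; case: (a \in c); rewrite /= ?addr0.
    rewrite [X in _ + X](reindex (prev c)) /=; last exact: onW_bij.
    rewrite -big_split; apply: eq_bigr => a _; rewrite /= mem_prev.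
    have [/gT /andP[_ /eqP<-]//|/gout->] := boolP (a \in c).
    by rewrite (wt_partner Mf fK f'K) // addr0.
  rewrite (bigD1 a0) //= a0c ltr_wpDr //.
  by apply: sumr_ge0 => a _; case: ifP.
(* The only edges that lose slack join a partner of a node of [C] to a node outside [X]. They are
   not tight, and integrality makes their slack at least 1. *)
pose z u := match u with
  | inl a => alpha (inl a) + (a \in X)%:R
  | inr b => alpha (inr b) - (f' b \in C)%:R end.
have feas_z : lp_feasible G M z.
  move=> a b ab; rewrite /z; have ab_feas := feas a b ab.
  have [bC|_] := boolP (f' b \in C); last first.
    by rewrite subr0; case: (a \in X); rewrite /=; lra.
  have [_|aX] := boolP (a \in X); first by lra.
  suff : (wt G M a b)%:~R + 1 <= alpha (inl a) + alpha (inr b) by rewrite /=; lra.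
  have : (wt G M a b)%:~R < alpha (inl a) + alpha (inr b).
    rewrite lt_neqAle ab_feas andbT; apply: contra aX => ab_tight.
    rewrite inE; apply/existsP; exists (f' b).
    by rewrite bC andTb /tight /= f'K ab eq_sym.
  have [u ->] := int_alpha (inl a); have [v ->] := int_alpha (inr b).
  by rewrite -intrD -[1]/(1%:~R) -intrD ltr_int ler_int; lia.
have := opt z feas_z; rewrite !big_sumType /= big_split sumrB /=.
have -> : \sum_a (a \in X)%:R = #|X|%:R :> R.
  by rewrite -natr_sum -sum1_card [in RHS]big_mkcond; congr _%:R; apply: eq_bigr => a _; case: (_ \in _).
have -> : \sum_b (f' b \in C)%:R = #|C|%:R :> R.
  rewrite (reindex f) /=; last exact: onW_bij.
  rewrite -natr_sum -sum1_card [in RHS]big_mkcond; congr _%:R; apply: eq_bigr => a _.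
  by rewrite fK; case: (_ \in _).
(* The shift changes the objective by the size of [X] minus that of [C]. *)
suff : (#|X|%:R : R) < #|C|%:R by lra.
rewrite ltr_nat; apply: proper_card; apply/properP; split; last first.
  by exists a0; rewrite // inE connect0.
apply/subsetP => x; rewrite inE => /existsP[y /andP[]]; rewrite !inE => h1 h2.
exact: connect_trans h1 (connect1 h2).
Qed.

End PerfectMatchings.

(** * Membership in [S] in terms of levels *)

Section Levels.
Variables (R : realFieldType) (A B : finType) (n0 : nat) (M : {set A * B}).
Variables (alpha : A + B -> R) (f : A -> B) (lev : A -> nat).
Hypotheses (Mf : matching_fun M f) (lev_lt : forall a, (lev a < n0)%N).
Hypotheses (alphaA : forall a, alpha (inl a) = - (2 * lev a)%:R)
           (alphaB : forall a, alpha (inr (f a)) = (2 * lev a)%:R).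

Let alphaA_eq a (i : nat) : (alpha (inl a) == - (2 * i)%:R) = (lev a == i).
Proof. by rewrite alphaA eqr_opp eqr_nat eqn_pmul2l. Qed.

Lemma mem_S_tilde a (j : 'I_n0) b :
  ((((a, j) : Astar A n0), (inl b : Bstar A B n0)) \in S_matching n0 M alpha)
  = (f a == b) && (lev a == j).
Proof.
rewrite !inE orbF; apply/bigcupP/andP => [[i _ /imsetP[[a' b'] /=]]|[/eqP<- /eqP e]].
  rewrite !inE /= Mf alphaA_eq => /and3P[/eqP<- /eqP e _] [-> -> ->].
  by rewrite e !eqxx.
exists j => //; apply/imsetP; exists (a, f a) => //.
by rewrite !inE Mf alphaA_eq alphaB e !eqxx.
Qed.

Lemma mem_S_dummy a (j : 'I_n0) a' (k : 'I_n0.-1) :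
  ((((a, j) : Astar A n0), (inr (a', k) : Bstar A B n0)) \in S_matching n0 M alpha)
  = (a' == a) && (((j < lev a)%N && (k == j :> nat))
                  || ((lev a < j)%N && (k.+1 == j :> nat))).
Proof.
rewrite in_setU [X in _ || X]inE /=.
have -> /= : (((a, j) : Astar A n0), (inr (a', k) : Bstar A B n0))
          \in S_main n0 M alpha = false.
  by apply/negP => /bigcupP[i _ /imsetP[]].
congr (_ && _); apply/existsP/idP => [[i]|h].
  by rewrite alphaA_eq => /andP[/eqP->].
by exists (Ordinal (lev_lt a)); rewrite alphaA_eq eqxx.
Qed.

End Levels.

(** * Stability of [S] *)

Theorem theorem4 (R : realFieldType) (A B : finType) (G : bip_inst A B)
    (n0 : nat) (M : {set A * B}) (alpha : A + B -> R)
    (hG : strict_rankings G)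
    (hperf : exists N : {set A * B}, perfect_matching G N)
    (hA : #|A| = n0) (hB : #|B| = n0)
    (hM : popular_perfect G M)
    (hopt : lp_optimal G M alpha)
    (halphaA : forall a : A,
       exists2 i : nat, (i < n0)%N & alpha (inl a) = - (2 * i)%:R)
    (halphaB : forall b : B,
       exists2 i : nat, (i < n0)%N & alpha (inr b) = (2 * i)%:R) :
  stable_matching (Gstar n0 G) (S_matching n0 M alpha).
Proof.
have [f [Mf bij_f fE]] := perfect_matching_fun (proj1 hM).
have [f' fK f'K] := bij_f.
have [lev lev_lt alphaA] := fin_all_exists2 halphaA.
have int_alpha u : exists z : int, alpha u = z%:~R.
  case: u => [a|b]; first by exists (- (2 * lev a)%:Z); rewrite alphaA rmorphN.
  by have [i _ ->] := halphaB b; exists (2 * i)%:Z.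
have alphaB a : alpha (inr (f a)) = (2 * lev a)%:R.
  have := popular_perfect_tight hG hM hopt int_alpha Mf bij_f fE a.
  by rewrite alphaA; lra.
have mem_t := mem_S_tilde Mf alphaA alphaB.
have mem_d := mem_S_dummy M lev_lt alphaA.
(* Copies below the level of [a] take their last choice [d_{j+1}(a)], those above it their first
   choice [d_j(a)], and the copy at the level takes the partner of [a] in [M]. *)
have S_matchedA u : matchedA (S_matching n0 M alpha) u.
  case: u => a j; apply/existsP; case: (ltngtP j (lev a)) => h.
  - have lt_j : (j < n0.-1)%N by have := lev_lt a; lia.
    by exists (inr (a, Ordinal lt_j)); rewrite mem_d /= h !eqxx.
  - have lt_j : (j.-1 < n0.-1)%N by have := ltn_ord j; lia.
    by exists (inr (a, Ordinal lt_j)); rewrite mem_d /= h !eqxx; lia.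
  - by exists (inl (f a)); rewrite mem_t h !eqxx.
have S_matchedB v : matchedB (S_matching n0 M alpha) v.
  case: v => [b|[a k]]; apply/existsP.
    by exists (f' b, Ordinal (lev_lt (f' b))); rewrite mem_t f'K !eqxx.
  have lt_k : (k < n0)%N by have := ltn_ord k; lia.
  have lt_k1 : (k.+1 < n0)%N by have := ltn_ord k; lia.
  case: (ltnP k (lev a)) => h.
    by exists (a, Ordinal lt_k); rewrite mem_d /= h !eqxx.
  by exists (a, Ordinal lt_k1); rewrite mem_d /= ltnS h !eqxx orbT.
split; first split.
- move=> [a j] [b|[a' k]]; first by rewrite mem_t => /andP[/eqP<- _]; exact: fE.
  by rewrite mem_d /= => /andP[-> /orP[|] /andP[_ /eqP->]]; rewrite eqxx ?orbT.
- move=> [a j] [b|[a1 k]] [b'|[a2 k']]; rewrite ?mem_t ?mem_d.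
  + by move=> /andP[/eqP<- _] /andP[/eqP<- _].
  + by move=> /andP[_ /eqP->]; rewrite ltnn /= andbF.
  + by move=> h /andP[_ /eqP e]; move: h; rewrite e ltnn /= andbF.
  + move=> /andP[/eqP-> h] /andP[/eqP-> h']; congr (inr (_, _)); apply: val_inj => /=.
    lia.
- move=> [a j] [a' j'] [b|[a1 k]]; rewrite ?mem_t ?mem_d.
  + move=> /andP[/eqP<- /eqP e] /andP[/eqP /(can_inj fK) -> /eqP e'].
    by congr (_, _); apply: val_inj; rewrite /= -e -e'.
  + move=> /andP[/eqP<- h] /andP[/eqP<- h']; congr (_, _); apply: val_inj => /=.
    lia.
- move=> [a j] v; rewrite /blocks S_matchedA S_matchedB /=.
  apply/negP => /and3P[].
  case: v => [b|[a' k]] /= e /existsP[v /andP[Sv pv]] /existsP[[c l] /andP[Sc pc]].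
  + move: Sc pc; rewrite mem_t /= => /andP[/eqP cb /eqP lc] pc.
    (* Feasibility bounds [wt] of [(a, b)] by [2 * lev c - 2 * lev a], where [c] is the partner of
       [b] in [M] and [l] is its level. *)
    have := proj1 hopt a b e.
    rewrite -{2}cb alphaA alphaB (wtE G Mf fK f'K) e /=.
    have -> : f' b = c by rewrite -cb fK.
    have eb : edge G c b by rewrite -cb.
    case: v Sv pv => [b'|[a1 k]].
      (* Here [a] has level [j] and prefers [b] to its partner, so the weight is at least 0. The
         bound is negative if [l < j]; if [l = j] it is 0 while the edge blocks [M] and weighs 2. *)
      rewrite mem_t => /andP[/eqP<- /eqP la] /= pa.
      rewrite pa (ranks_strictly_asym (proj1 hG a) e (fE a) pa) /=.
      case/orP: pc => [ltlj|/andP[/eqP jl pb]].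
        have : (2 * lev c)%:R < (2 * lev a)%:R :> R by rewrite ltr_nat; lia.
        by case: prefB; lra.
      by rewrite pb la lc jl; lra.
    (* The dummy partner is worse than [b], hence it is [d_{j+1}(a)] and [j < lev a]. If [l < j] the
       bound is at most -4, below every weight. If [l = j] it is negative, while [b] prefers [a] to
       [c], so the weight is at least 0. *)
    rewrite mem_d /tier /= => /andP[_ h]; case: eqP => // jk _.
    have {h} ltj : (j < lev a)%N by case/orP: h => /andP[h1 /eqP h2]; lia.
    case/orP: pc => [ltlj|/andP[/eqP jl pb]].
      have : (2 * lev c + 4)%:R <= (2 * lev a)%:R :> R by rewrite ler_nat; lia.
      by rewrite natrD; case: ifP => _; [|case: ifP => _]; lra.
    rewrite (ranks_strictly_asym (proj2 hG b) e eb pb) andbF.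
    have : (2 * lev c)%:R < (2 * lev a)%:R :> R by rewrite ltr_nat lc -jl; lia.
    by case: ifP => _; lra.
  (* A dummy that would gain by a switch is matched to its second choice, so [a_j] is its first
     choice. That dummy is then the last choice of [a_j], which cannot prefer it to its partner. *)
  + move: Sc pc; rewrite mem_d => /andP[_ h] /= jl.
    have jk : (j == k :> nat) by case/andP: e => _; lia.
    move: pv; rewrite /prefA_star /tier /=.
    have -> : (j == k.+1 :> nat) = false by lia.
    by case: v {Sv} => [b|[a1 k1]] //=; case: ifP.
Qed.
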